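(* The NGEV equilibrium assignment is equivalent to the following fixed-point problem. [FP-D] Find $\mathbf x^*=\sum_{d\in\mathcal D}\mathbf x_d^*\in X\cap Y$ such that $$\mathbf x_d^*=\mathbf F_d(\mathbf C(\mathbf x^* ))\quad\text{for all }d\in\mathcal D.$$
   Context: Network. $G=(\mathcal N,\mathcal L)$ is a finite directed time-space network; $\mathcal L=\mathcal L_T\cup\mathcal L_A\cup\mathcal L_B\cup\mathcal L_Q$ is partitioned into time-space (driving), access/egress/transfer, on-board and boarding-queue links. $\Psi$ is the set of run-station pairs $(r,s)$, and $\mathcal L_Q$ is the disjoint union of sets $\mathcal L_Q^{(r,s)}$, $(r,s)\in\Psi$, each consisting of links numbered $l=1,\dots,N$. For each $(r,s)$ there is a sequence of on-board nodes $1,\dots,N$; the $l$-th boarding-queue link (flow $z_l^{(r,s)}$) enters the $l$-th on-board node, the $l$-th on-board link (flow $x_l^{(r,s)}$) leaves it, and $x_0^{(r,s)}$ is the flow on the link of run $r$ entering the first on-board node; flow conservation gives $x_l^{(r,s)}=x_{l-1}^{(r,s)}+z_l^{(r,s)}=x_0^{(r,s)}+\sum_{k=1}^l z_k^{(r,s)}$. Costs. The vector link cost function $\mathbf C$ maps aggregated link flows $\mathbf x\in\mathbb R_+^{|\mathcal L|}$ to link costs as follows. The cost of each link $ij\in\mathcal L_T\cup\mathcal L_A\cup\mathcal L_B$ is a continuous, differentiable, strictly increasing function of its own flow $x_{ij}$. On-board links of run $r$ have capacity $\mu^{(r)}$, and the cost of the $l$-th boarding-queue link of $(r,s)$ is $f_l\big(x_0^{(r,s)}+\sum_{k=1}^l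 z_k^{(r,s)}\mid\mu^{(r)}\big)$, where $f_l(\cdot\mid\mu)$ is continuous, differentiable and strictly increasing with $\lim_{x\to\mu}f_l(x\mid\mu)=+\infty$ (value $+\infty$ for $x\ge\mu$). Costs are nonnegative. $Y$ (supply-feasible flows) is the set of $\mathbf x\in\mathbb R_+^{|\mathcal L|}$ with $\mathbf C(\mathbf x)$ finite; $\mathcal C=\{\mathbf C(\mathbf x):\mathbf x\in Y\}$. Demand. $\mathcal D$ is the set of destinations; $\mathbf q_d=(q_i^d)_{i\in\mathcal N}$ is the given demand to $d$, with $q_i^d>0$ when $(i,d)$ is an origin-destination pair and $q_i^d=0$ otherwise. $\mathcal F(i)$ and $\mathcal B(i)$ are the sets of successor and predecessor nodes of $i$. $X_d$ is the set of $\mathbf x_d=(x^d_{ij})_{ij\in\mathcal L}\ge\mathbf 0$ with $\sum_{n\in\mathcal F(i)}x_{in}^d-\sum_{n\in\mathcal B(i)}x_{ni}^d=q_i^d$ for all $i\in\mathcal N\setminus\{d\}$. $\hat X=\prod_{d\in\mathcal D}X_d$, with elements $\hat{\mathbf x}=(\mathbf x_d)_{d\in\mathcal D}$; $X=\{\sum_d\mathbf x_d:\hat{\mathbf x}\in\hat X\}$. NGEV equilibrium assignment. Parameters: $\theta_i^d>0$ and $\alpha_{ji}^d\ge0$ with $\sum_{i\in\mathcal B(j)}\alpha_{ji}^d=1$. The problem is to find link costs $\mathbf c=(c_{ij})$, flows $\hat{\mathbf x}\in\hat X$ with $\mathbf x=\sum_d\mathbf x_d\in X\cap Y$, and expected minimum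 costs $(s_{id})_{i\in\mathcal N,d\in\mathcal D}$ (with $s_{dd}=0$) such that $\mathbf c=\mathbf C(\mathbf x)$ and, for all $d\in\mathcal D$, all $i\in\mathcal N\setminus\{d\}$ and all links $ij$, $$p^d_{ij|i}=\frac{\alpha^d_{ji}e^{-\theta^d_i(c_{ij}+s_{jd})}}{\sum_{n\in\mathcal F(i)}\alpha^d_{ni}e^{-\theta^d_i(c_{in}+s_{nd})}},\quad 1=\sum_{n\in\mathcal F(i)}\alpha^d_{ni}e^{-\theta^d_i(c_{in}+s_{nd}-s_{id})},\quad x^d_{ij}=p^d_{ij|i}\sum_{n\in\mathcal F(i)}x^d_{in}.$$ Optimal solution map. With the convention $0\ln0=0$, $$H_d(\mathbf x_d)=-\sum_{i\in\mathcal N}\frac1{\theta_i^d}\sum_{j\in\mathcal F(i)}x_{ij}^d\Big[\ln\frac{x_{ij}^d}{\sum_{n\in\mathcal F(i)}x_{in}^d}-\ln\alpha_{ji}^d\Big],$$ and for $\mathbf c\in\mathcal C$, $\mathbf F_d(\mathbf c)$ is the unique minimizer of $\mathbf c\cdot\mathbf x_d-H_d(\mathbf x_d)$ over $\mathbf x_d\in X_d$. Equivalence means that $\hat{\mathbf x}^*$ is the flow component of a solution of the NGEV equilibrium assignment if and only if it solves the stated problem.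
   Formalization: The time-space network is taken to be acyclic; α is normalized only at nodes with predecessors; at nodes with no route to d along links with α>0, s_id=+∞, the equation for s_id is not imposed and p=0; minimizers must have finite objective. *)

(* Defs.v *)
From HB Require Import structures.
From mathcomp Require Import all_boot all_order all_algebra.
From mathcomp Require Import all_classical all_reals all_analysis.
Import Order.TTheory GRing.Theory Num.Theory.
Import numFieldNormedType.Exports.

Set Implicit Arguments.
Unset Strict Implicit.
Unset Printing Implicit Defensive.

Local Open Scope classical_set_scope.
Local Open Scope ring_scope.

(* The partition of the links; the boarding-queue links are classified together
   with their run-station pair and their number.  Positions 1, ..., N are
   represented by 'I_N, hence shifted by one. *)
Inductive link_class (Psi : Type) (N : nat) : Type :=
  | TimeSpace
  | Access
  | OnBoard
  | Queue of Psi & 'I_N.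

Arguments TimeSpace {Psi N}.
Arguments Access {Psi N}.
Arguments OnBoard {Psi N}.

(* A link a is the ordered pair ij with i = tail a and j = head a, so a sum over
   n in F(i) is a sum over the links a with tail a = i, and a sum over n in B(j)
   is a sum over the links a with head a = j. *)
Record network : Type := Network {
  node : finType;
  link : finType;
  tail : link -> node;
  head : link -> node;
  link_pair_inj : injective (fun a => (tail a, head a));

  (* In a time-space network no link goes back in time, and so no directed cycle
     exists. *)
  acyclic : forall a,
    ~~ connect (fun i j => [exists b, (tail b == i) && (head b == j)])
         (head a) (tail a);

  run : finType;
  station : finType;
  run_stations : {set run * station};

  N : nat;
  N_gt0 : (0 < N)%N;
  class : link -> link_class {rs | rs \in run_stations} N;
  queue : {rs | rs \in run_stations} -> 'I_N -> link;
  queueP : forall rs l a, class a = Queue rs l <-> a = queue rs l;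

  onboard_node : {rs | rs \in run_stations} -> 'I_N -> node;
  board : {rs | rs \in run_stations} -> 'I_N -> link;
  (* the link carrying x_0 *)
  entry : {rs | rs \in run_stations} -> link;
  class_board : forall rs l, class (board rs l) = OnBoard;
  class_entry : forall rs rs' l, class (entry rs) <> Queue rs' l;

  (* These incidences are exactly those under which flow conservation reads
     x_l = x_(l-1) + z_l at the l-th on-board node. *)
  enter_first : forall rs (l : 'I_N) a, l = 0%N :> nat ->
    head a = onboard_node rs l <-> a = entry rs \/ a = queue rs l;
  enter_next : forall rs (k l : 'I_N) a, l = k.+1 :> nat ->
    head a = onboard_node rs l <-> a = board rs k \/ a = queue rs l;
  leave : forall rs l a, tail a = onboard_node rs l <-> a = board rs l
}.

Definition run_station (G : network) : Type := {rs | rs \in run_stations G}.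

Definition flow (R : realType) (G : network) := {ffun link G -> R}.

(* Continuity and differentiability are relative to A, hence one-sided at an end
   point of an interval A. *)
Definition smooth_increasing (R : realType) (A : set R) (g : R -> R) : Prop :=
  [/\ {within A, continuous g},
      forall x, A x -> cvg ((g y - g x) / (y - x) @[y --> within A x^'])
    & forall x y, A x -> A y -> x < y -> g x < g y].

Record costs (R : realType) (G : network) : Type := Costs {
  (* Separable cost of a link as a function of its own flow; its value is
     irrelevant on boarding-queue links. *)
  sep_cost : link G -> R -> R;
  sep_cost_smooth : forall a, (forall rs l, class a <> Queue rs l) ->
    smooth_increasing `[0, +oo[ (sep_cost a);
  sep_cost_ge0 : forall a x, (forall rs l, class a <> Queue rs l) ->
    0 <= x -> 0 <= sep_cost a x;

  capacity : run G -> R;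
  capacity_gt0 : forall r, 0 < capacity r;

  (* queue_cost l mu x is f_l(x | mu) *)
  queue_cost : 'I_(N G) -> R -> R -> \bar R;
  queue_cost_fin : forall l mu x, 0 < mu -> 0 <= x < mu ->
    queue_cost l mu x \is a fin_num;
  queue_cost_over : forall l mu x, 0 < mu -> mu <= x ->
    queue_cost l mu x = +oo%E;
  queue_cost_smooth : forall l mu, 0 < mu ->
    smooth_increasing `[0, mu[ (fine \o queue_cost l mu);
  queue_cost_lim : forall l mu, 0 < mu ->
    queue_cost l mu x @[x --> mu^'-] --> +oo%E;
  queue_cost_ge0 : forall l mu x, 0 < mu -> 0 <= x ->
    (0 <= queue_cost l mu x)%E
}.

Definition link_cost (R : realType) (G : network) (K : costs R G)
    (x : flow R G) (a : link G) : \bar R :=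
  match class a with
  | Queue rs l =>
      queue_cost K l (capacity K (val rs).1)
        (x (entry rs) + \sum_(k < N G | (k <= l)%N) x (queue rs k))
  | _ => (sep_cost K a (x a))%:E
  end.

(* Y *)
Definition supply_feasible (R : realType) (G : network) (K : costs R G) :
    set (flow R G) :=
  [set x : flow R G | (forall a, 0 <= x a) /\ (forall a, link_cost K x a \is a fin_num)].

Record demand (R : realType) (G : network) : Type := Demand {
  dests : {set node G};
  od : {set node G * node G};
  od_dest : forall i d, (i, d) \in od -> d \in dests;
  q : {d | d \in dests} -> node G -> R;
  q_gt0 : forall d i, (i, val d) \in od -> 0 < q d i;
  q_eq0 : forall d i, (i, val d) \notin od -> q d i = 0;
  (* needed for conservation to read x_l = x_(l-1) + z_l at on-board nodes *)
  onboard_not_origin : forall (rs : run_station G) l d,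
    (onboard_node rs l, d) \notin od;
  onboard_not_dest : forall (rs : run_station G) l,
    onboard_node rs l \notin dests
}.

Definition dest (R : realType) (G : network) (M : demand R G) :=
  {d | d \in dests M}.

Section Assignment.
Variables (R : realType) (G : network) (M : demand R G).

Definition outflow (x : flow R G) (i : node G) : R :=
  \sum_(a | tail a == i) x a.

Definition inflow (x : flow R G) (i : node G) : R :=
  \sum_(a | head a == i) x a.

(* X_d *)
Definition dest_feasible (d : dest M) : set (flow R G) :=
  [set x : flow R G | (forall a, 0 <= x a) /\
           (forall i, i != val d -> outflow x i - inflow x i = q d i)].

(* \hat X *)
Definition demand_feasible_hat : set (dest M -> flow R G) :=
  [set xh : dest M -> flow R G | forall d, dest_feasible d (xh d)].

Definition total_flow (xh : dest M -> flow R G) : flow R G := \sum_d xh d.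

(* X *)
Definition demand_feasible : set (flow R G) :=
  total_flow @` demand_feasible_hat.

Record ngev_params : Type := NgevParams {
  theta : dest M -> node G -> R;
  theta_gt0 : forall d i, 0 < theta d i;
  (* alpha d a is alpha_(ji)^d for the link a = ij *)
  alpha : dest M -> link G -> R;
  alpha_ge0 : forall d a, 0 <= alpha d a;
  (* A node without predecessors carries no normalization. *)
  alpha_sum : forall d j, (exists a, head a = j) ->
    \sum_(a | head a == j) alpha d a = 1
}.

Variables (K : costs R G) (P : ngev_params).

(* There is a route from i to d made of links with alpha > 0. *)
Definition has_route (d : dest M) (i : node G) : bool :=
  connect (fun j k => [exists a, [&& tail a == j, head a == k & 0 < alpha P d a]])
    i (val d).

(* e^(- t v), equal to 0 at v = +oo when t > 0 *)
Definition exp_cost (t : R) (v : \bar R) : R :=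
  fine (expeR (- (t%:E * v))%E).

(* At a node without route to d the quotient is 0 / 0 = 0. *)
Definition choice_prob (c : flow R G) (s : node G -> dest M -> \bar R)
    (d : dest M) (a : link G) : R :=
  let w b :=
    alpha P d b * exp_cost (theta P d (tail a)) ((c b)%:E + s (head b) d)%E in
  w a / \sum_(b | tail b == tail a) w b.

(* Expected minimum costs are real exactly at the nodes having a route to d.  At
   the other nodes (for instance at another destination without outgoing link)
   they are +oo, the equation defining s would read +oo - oo and is not imposed,
   and the choice probabilities vanish so that no flow goes through. *)
Definition ngev_equilibrium (c : flow R G) (xh : dest M -> flow R G)
    (s : node G -> dest M -> \bar R) : Prop :=
  [/\ [/\ demand_feasible_hat xh,
          (demand_feasible `&` supply_feasible K) (total_flow xh)
        & forall a, (c a)%:E = link_cost K (total_flow xh) a],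
      [/\ forall d, s (val d) d = 0%E,
          forall d i, has_route d i -> s i d \is a fin_num
        & forall d i, ~~ has_route d i -> s i d = +oo%E],
      forall d i, i != val d -> has_route d i ->
        1 = \sum_(a | tail a == i) alpha P d a *
              exp_cost (theta P d i) ((c a)%:E + s (head a) d - s i d)%E
    & forall d a, tail a != val d ->
        xh d a = choice_prob c s d a * outflow (xh d) (tail a)].

(* The logarithm is lne, with lne 0 = -oo, and 0 * (-oo) = 0: thus 0 ln 0 = 0,
   and H_d = -oo for a flow using a link with alpha = 0. *)
Definition entropy (d : dest M) (x : flow R G) : \bar R :=
  (- \sum_i (theta P d i)^-1%:E *
       \sum_(a | tail a == i)
          (x a)%:E * (lne (x a / outflow x i)%:E - lne (alpha P d a)%:E))%E.

Definition objective (d : dest M) (c x : flow R G) : \bar R :=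
  ((\sum_a c a * x a)%:E - entropy d x)%E.

(* A flow at which the objective is +oo is outside the domain of H_d and does not
   count as a minimizer. *)
Definition minimizers (d : dest M) (c : flow R G) : set (flow R G) :=
  [set x : flow R G | [/\ dest_feasible d x, (objective d c x < +oo)%E
             & forall y, dest_feasible d y ->
                 (objective d c x <= objective d c y)%E]].

(* The graph x = F_d(c) of the optimal solution map: x is the unique minimizer. *)
Definition optimal_flow (d : dest M) (c x : flow R G) : Prop :=
  minimizers d c = [set x].

Definition FP_D (xh : dest M -> flow R G) : Prop :=
  let x := total_flow xh in
  (demand_feasible `&` supply_feasible K) x /\
  forall d, optimal_flow d [ffun a => fine (link_cost K x a)] (xh d).

End Assignment.

(* Main.v *)
From mathcomp Require Import all_boot all_order all_algebra.
From mathcomp Require Import all_classical all_reals all_analysis.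
From mathcomp Require Import ring lra.
Require Import Defs.
Import Order.TTheory GRing.Theory Num.Theory.

(** Fix the link costs c and a destination d.  The conditions on the expected
minimum costs s do not involve the flows: they are a Bellman recursion
([bellman]), which on an acyclic network has a solution, computed from d upstream
([exists_bellman]).  Such a solution turns the logit quotient into

  p_a = alpha_a exp (- theta (c_a + s_head - s_tail)),

that is, c_a = (ln alpha_a - ln p_a) / theta + s_tail - s_head.  Substitute this
in c . x - H_d(x).  By flow conservation the potential differences sum up to
sum_i q_i s_i, the same number for all feasible x, and what remains is a weighted
sum of relative entropies of the actual splits with respect to p
([free_energy_divergence]):

  c . x - H_d(x) = sum_i q_i s_i + sum_a D(x_a | p_a * outflow_tail) / theta,

where D(u | v) = u ln (u / v) - u + v is nonnegative and vanishes only at u = v.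
So a feasible flow that splits at each node according to p, called [loaded] here,
attains the lower bound sum_i q_i s_i, and every other flow attaining it is loaded
too.  Loading determines the flow, since node throughputs are obtained downstream
one after the other; hence a loaded flow is the unique minimizer
([minimizers_loaded]).

An NGEV equilibrium is precisely a solution of the Bellman equations at
c = C(x) together with loaded flows ([equilibrium_loadedP]), so that it solves the
fixed-point problem.  Conversely, let the flows solve the fixed-point problem.
Take a Bellman solution for c = C(x); as some feasible flow has finite objective,
the demand can be loaded ([exists_loaded]), and by the above the loaded flow is the
minimizer, namely the given one.

Infinite values need care in three places.  The objective is finite exactly at the
flows supported on links with alpha > 0 ([objective_supported],
[supported_objective]).  Such a flow only passes through nodes having a route to
d, where s is real ([support_reaches]).  Finally, no feasible flow leaves d, because
it could never come back to be absorbed ([outflow_dest]), so that the splitting rule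
holds at d too, in the form 0 = 0. *)

Set Implicit Arguments.
Unset Strict Implicit.
Unset Printing Implicit Defensive.

Local Open Scope ring_scope.

(** * Recursion along a measure *)

(** The recursion scheme behind both passes over the acyclic network (costs
upstream, throughputs downstream).  Iterating F stabilizes at i after more than
mu i steps, and b steps suffice everywhere. *)
Lemma measure_fixpoint (T A : Type) (mu : T -> nat) (b : nat)
    (F : (T -> A) -> T -> A) (a0 : A) :
  (forall i, (mu i < b)%N) ->
  (forall f g i, (forall j, (mu j < mu i)%N -> f j = g j) -> F f i = F g i) ->
  exists f, forall i, f i = F f i.
Proof.
move=> mub Floc.
have stable : forall m n p i, (mu i < m)%N -> (m <= n)%N -> (m <= p)%N ->
    iter n F (fun=> a0) i = iter p F (fun=> a0) i.
  elim=> [//|m IHm] [//|n] [//|p] i im mn mp.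
  apply: Floc => j ji; apply: IHm => //.
  by rewrite (leq_trans ji) // -ltnS.
exists (iter b F (fun=> a0)) => i.
by rewrite -[RHS]/(iter b.+1 F (fun=> a0) i) (stable b b b.+1 i).
Qed.

(** * Relative entropy *)

(** The Kullback-Leibler integrand for measures of unequal mass: the linear
correction makes each single term nonnegative, and the corrections cancel in the
sum when the two measures have the same mass. *)
Definition divergence (R : realType) (u v : R) := u * ln (u / v) - u + v.

(** With t = ln (v / u) the divergence is u (exp t - 1 - t).  The hypothesis
0 < u -> 0 < v excludes the pairs where the true divergence is infinite. *)
Lemma divergence_ge0 (R : realType) (u v : R) :
  0 <= u -> 0 <= v -> (0 < u -> 0 < v) -> 0 <= divergence u v.
Proof.
rewrite /divergence le_eqVlt => /predU1P[<-|u0] v0; first by rewrite mul0r; lra.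
move=> /(_ u0) {}v0.
rewrite ln_div ?posrE //.
have [e1 e2] : expR (ln u) = u /\ expR (ln v) = v by rewrite !lnK ?posrE.
have := expR_ge1Dx (ln v - ln u); rewrite expRB e1 e2 => h.
have {h} : u * (1 + (ln v - ln u)) <= u * (v / u) by rewrite ler_pM2l.
by rewrite mulrCA divff ?gt_eqF // mulr1; lra.
Qed.

(** Same substitution as for nonnegativity, with the strict inequality
1 + t < exp t for t <> 0. *)
Lemma divergence_eq0 (R : realType) (u v : R) :
  0 <= u -> 0 <= v -> (0 < u -> 0 < v) -> (divergence u v == 0) = (u == v).
Proof.
rewrite /divergence le_eqVlt => /predU1P[<-|u0] v0.
  by move=> _; rewrite mul0r subr0 add0r eq_sym.
move=> /(_ u0) {}v0.
apply/idP/idP => [|/eqP <-]; last first.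
  by rewrite divff ?lt0r_neq0 // ln1 mulr0 sub0r addNr.
apply: contraTT => uv; rewrite gt_eqF //.
rewrite ln_div ?posrE //.
have [e1 e2] : expR (ln u) = u /\ expR (ln v) = v by rewrite !lnK ?posrE.
have h0 : ln v - ln u != 0.
  by apply: contra uv; rewrite subr_eq0 => /eqP h; rewrite -e1 -e2 h.
have := expR_gt1Dx h0; rewrite expRB e1 e2 => h.
have {h} : u * (1 + (ln v - ln u)) < u * (v / u) by rewrite ltr_pM2l.
by rewrite mulrCA divff ?gt_eqF // mulr1; lra.
Qed.

(** * Acyclic networks *)

(** Adjacency through the links satisfying Q: with Q true everywhere it is the
adjacency of the network, and with Q the positivity of alpha its connectedness is
[has_route]. *)
Definition edge (G : network) (Q : pred (link G)) : rel (node G) :=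
  fun i j => [exists a, [&& tail a == i, head a == j & Q a]].

Lemma edge_link (G : network) (Q : pred (link G)) (a : link G) :
  Q a -> edge Q (tail a) (head a).
Proof. by move=> Qa; apply/existsP; exists a; rewrite !eqxx. Qed.

Lemma connect_acyclic (G : network) (Q : pred (link G)) (a : link G) :
  ~~ connect (edge Q) (head a) (tail a).
Proof.
apply: contra (acyclic a); apply: connect_sub => i j /existsP[b].
by move=> /and3P[ti hj _]; apply/connect1/existsP; exists b; rewrite ti hj.
Qed.

(** The number of nodes reachable from i, which drops strictly along each link
because the network is acyclic. *)
Definition rank (G : network) (i : node G) : nat := #|connect (edge predT) i|.

Lemma rank_head (G : network) (a : link G) : (rank (head a) < rank (tail a))%N.
Proof.
apply: proper_card; apply/properP; split; last first.
  by exists (tail a); rewrite !inE ?connect0 ?connect_acyclic.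
apply/fintype.subsetP => i; rewrite !inE; apply: connect_trans.
exact/connect1/edge_link.
Qed.

Lemma rank_le (G : network) (i : node G) : (rank i <= #|node G|)%N.
Proof. exact: max_card. Qed.

Lemma upstream_ind (G : network) (Q : node G -> Prop) :
  (forall i, (forall a, head a = i -> Q (tail a)) -> Q i) -> forall i, Q i.
Proof.
move=> step i; have [n] := ubnP (#|node G| - rank i)%N.
elim: n i => // n IHn i /ltnSE ri; apply: step => a ha; apply: IHn.
apply: leq_trans ri; rewrite -ha.
exact: ltn_sub2l (leq_trans (rank_head a) (rank_le _)) (rank_head a).
Qed.

Lemma downstream_ind (G : network) (Q : node G -> Prop) :
  (forall i, (forall a, tail a = i -> Q (head a)) -> Q i) -> forall i, Q i.
Proof.
move=> step i; have [n] := ubnP (rank i).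
elim: n i => // n IHn i /ltnSE ri; apply: step => a ta; apply: IHn.
by apply: leq_trans ri; rewrite -ta; exact: rank_head.
Qed.

(** * Feasible flows *)

Lemma sum_by_tail (G : network) (V : nmodType) (f : link G -> V) :
  \sum_a f a = \sum_i \sum_(a | tail a == i) f a.
Proof. by rewrite (partition_big (@tail G) predT). Qed.

Lemma sum_by_head (G : network) (V : nmodType) (f : link G -> V) :
  \sum_a f a = \sum_i \sum_(a | head a == i) f a.
Proof. by rewrite (partition_big (@head G) predT). Qed.

(** Summation by parts: along a flow the differences of a node potential only see
the divergence of the flow, which conservation fixes to be the demand. *)
Lemma sum_potential (R : realType) (G : network) (x : flow R G)
    (s : node G -> R) :
  \sum_a x a * (s (tail a) - s (head a)) =
  \sum_i (outflow x i - inflow x i) * s i.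
Proof.
under eq_bigr do rewrite mulrBr.
under [RHS]eq_bigr do rewrite mulrBl.
rewrite !big_split /= !sumrN sum_by_tail (sum_by_head (fun a => _ * s (head a))).
congr (_ - _); apply: eq_bigr => i _.
- by rewrite mulr_suml; apply: eq_bigr => a /eqP ->.
- by rewrite mulr_suml; apply: eq_bigr => a /eqP ->.
Qed.

Section Flows.
Variables (R : realType) (G : network) (M : demand R G) (d : dest M).
Implicit Types (x : flow R G) (i : node G) (a : link G).

Lemma demand_ge0 i : 0 <= q d i.
Proof.
case: (boolP ((i, val d) \in od M)) => [/q_gt0/ltW //|/q_eq0 -> //].
Qed.

Lemma outflow_ge0 x i : (forall a, 0 <= x a) -> 0 <= outflow x i.
Proof. by move=> x0; apply: sumr_ge0. Qed.

Lemma le_outflow x a : (forall b, 0 <= x b) -> x a <= outflow x (tail a).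
Proof.
move=> x0; rewrite /outflow (bigD1 a) //= lerDl.
exact: sumr_ge0.
Qed.

(** Conservation at a node other than d, where demand is nonnegative, forces what
enters to leave again. *)
Lemma outflow_head x a : dest_feasible d x -> 0 < x a -> head a != val d ->
  0 < outflow x (head a).
Proof.
move=> [x0 xcons] xa hd; move: (xcons _ hd) => /eqP; rewrite subr_eq => /eqP ->.
have : x a <= inflow x (head a).
  by rewrite /inflow (bigD1 a) //= lerDl; apply: sumr_ge0.
by move: (demand_ge0 (head a)); lra.
Qed.

Lemma outflow_gt0 x i : 0 < outflow x i -> exists2 a, tail a = i & 0 < x a.
Proof.
move=> oi; apply: contrapT => h; move: oi; rewrite ltNge => /negP; apply.
apply: sumr_le0 => a /eqP ti; rewrite leNgt; apply/negP => xa; apply: h.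
by exists a.
Qed.

(** Following links that carry flow one can only stop at d, so flow passes only
through nodes from which the support of x leads to d. *)
Lemma support_reaches x (Q : pred (link G)) i : dest_feasible d x ->
  (forall a, 0 < x a -> Q a) -> 0 < outflow x i -> connect (edge Q) i (val d).
Proof.
move=> fx xQ; elim/downstream_ind: i => i IHi /outflow_gt0[a ti xa].
apply: (@connect_trans _ _ (head a)); last first.
  case: (eqVneq (head a) (val d)) => [->|hd]; first exact: connect0.
  exact: IHi ti (outflow_head fx xa hd).
by rewrite -ti; apply/connect1/edge_link/xQ.
Qed.

Lemma support_head x (Q : pred (link G)) a : dest_feasible d x ->
  (forall b, 0 < x b -> Q b) -> 0 < x a -> connect (edge Q) (head a) (val d).
Proof.
move=> fx xQ xa; case: (eqVneq (head a) (val d)) => [->|hd]; first exact: connect0.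
exact: support_reaches fx xQ (outflow_head fx xa hd).
Qed.

(** A link leaving d and carrying flow would, by [support_head], lead back to d and
close a cycle. *)
Lemma outflow_dest x : dest_feasible d x -> outflow x (val d) = 0.
Proof.
move=> fx; apply/eqP; rewrite eq_le outflow_ge0; last by case: fx.
rewrite andbT leNgt; apply/negP => /outflow_gt0[a ta xa].
have := @connect_acyclic _ predT a; rewrite ta => /negP; apply.
exact: support_head fx _ xa.
Qed.

Lemma outflow_eq0 x a : (forall b, 0 <= x b) -> outflow x (tail a) = 0 -> x a = 0.
Proof.
by move=> x0 oa; apply/eqP; rewrite eq_le x0 andbT -oa le_outflow.
Qed.

Lemma support_tail x a : dest_feasible d x -> 0 < x a ->
  0 < outflow x (tail a) /\ tail a != val d.
Proof.
move=> fx xa; have oa : 0 < outflow x (tail a).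
  by apply: lt_le_trans xa (le_outflow _ _); case: fx.
by split=> //; apply: contraTneq oa => ->; rewrite outflow_dest // ltxx.
Qed.

Variables (P : ngev_params M) (c : flow R G).

(** * The objective in real numbers *)

(** The real value of c . x - H_d(x) at the flows where it is finite. *)
Definition free_energy x : R := \sum_a x a *
  (c a + (theta P d (tail a))^-1 * (ln (x a / outflow x (tail a)) - ln (alpha P d a))).

(** At an unused link the entropy term is 0 times a possibly infinite logarithm,
hence 0; at a used link all logarithms are real. *)
Lemma objective_supported x : (forall a, 0 <= x a) ->
  (forall a, 0 < x a -> 0 < alpha P d a) ->
  objective P d c x = (free_energy x)%:E.
Proof.
move=> x0 xal; rewrite /objective /entropy /free_energy oppeK.
under [X in (_ + X)%E]eq_bigr => i _.
  have -> : (\sum_(a | tail a == i)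
       (x a)%:E * (lne (x a / outflow x i)%:E - lne (alpha P d a)%:E) =
     (\sum_(a | tail a == i)
       x a * (ln (x a / outflow x (tail a)) - ln (alpha P d a)))%:E)%E.
    rewrite -sumEFin; apply: eq_bigr => a /eqP ti.
    have := x0 a; rewrite le_eqVlt => /predU1P[<-|xa].
      by rewrite mul0e mul0r.
    rewrite ti !lne_EFin ?xal // divr_gt0 //.
    by rewrite (lt_le_trans xa) // -ti le_outflow.
  over.
rewrite /=.
under [X in (_ + X)%E]eq_bigr do rewrite -EFinM.
rewrite sumEFin -EFinD; congr (_%:E).
rewrite sum_by_tail [RHS]sum_by_tail -big_split /=; apply: eq_bigr => i _.
rewrite mulr_sumr -big_split /=; apply: eq_bigr => a /eqP ->.
ring.
Qed.

(** Flow on a link with alpha = 0 contributes x * (ln _ - ln 0) = +oo, and no other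
term can cancel it since none equals -oo. *)
Lemma supported_objective x : (forall a, 0 <= x a) ->
  (objective P d c x < +oo)%E -> forall a, 0 < x a -> 0 < alpha P d a.
Proof.
move=> x0 obj a xa; rewrite lt_neqAle alpha_ge0 andbT; apply/negP => /eqP al0.
move: obj; suff -> : objective P d c x = +oo%E by [].
pose t (b : link G) i :=
  ((x b)%:E * (lne (x b / outflow x i)%:E - lne (alpha P d b)%:E))%E.
have tN b i : tail b == i -> t b i != -oo%E.
  move=> /eqP bi; rewrite /t; have := x0 b; rewrite le_eqVlt => /predU1P[<-|xb].
    by rewrite mul0e.
  have ob : 0 < outflow x i by rewrite -bi; exact: lt_le_trans xb (le_outflow _ _).
  rewrite (lne_EFin (divr_gt0 xb ob)).
  have := alpha_ge0 P d b; rewrite le_eqVlt => /predU1P[<-|ab].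
    by rewrite (le0_lneNy (lexx _)) /= addey // gt0_muley // lte_fin.
  by rewrite lne_EFin.
have ta : t a (tail a) = +oo%E.
  have oa : 0 < outflow x (tail a) by exact: lt_le_trans xa (le_outflow _ _).
  rewrite /t -al0 (lne_EFin (divr_gt0 xa oa)).
  by rewrite (le0_lneNy (lexx _)) /= addey // gt0_muley // lte_fin.
rewrite /objective /entropy oppeK.
suff -> : (\sum_i (theta P d i)^-1%:E * \sum_(b | tail b == i) t b i = +oo)%E.
  by rewrite addey.
have th i : (0 < (theta P d i)^-1%:E)%E by rewrite lte_fin invr_gt0 theta_gt0.
have sN i : (\sum_(b | tail b == i) t b i != -oo)%E.
  by rewrite esum_eqNy; apply/existsP => -[b /andP[bi]]; apply/negP/tN.
apply/eqP; rewrite esum_eqy; last first.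
  move=> i _; move: (sN i); case: (\sum_(b | _) _)%E => [r _||//] //.
  by rewrite gt0_muley.
apply/existsP; exists (tail a) => /=.
have /eqP -> : (\sum_(b | tail b == tail a) t b (tail a) == +oo)%E.
  rewrite esum_eqy; last by move=> b; exact: tN.
  by apply/existsP; exists a; apply/andP; split; [exact: eqxx|exact/eqP].
by rewrite gt0_muley.
Qed.

End Flows.

(** * Expected minimum costs *)

Section ExpectedCosts.
Variables (R : realType) (G : network) (M : demand R G).
Variables (P : ngev_params M) (c : flow R G).
Implicit Types (x : flow R G) (i : node G) (a : link G) (d : dest M).

(** The part of the equilibrium conditions that constrains the expected minimum
costs to a single destination when the link costs are given. *)
Definition bellman d (s : node G -> \bar R) : Prop :=
  [/\ s (val d) = 0%E,
      forall i, has_route P d i -> s i \is a fin_num,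
      forall i, ~~ has_route P d i -> s i = +oo%E
    & forall i, i != val d -> has_route P d i ->
        1 = \sum_(a | tail a == i) alpha P d a *
              exp_cost (theta P d i) ((c a)%:E + s (head a) - s i)%E].

Lemma exp_cost_ge0 (t : R) (v : \bar R) : 0 <= exp_cost t v.
Proof. by rewrite /exp_cost fine_ge0 // expeR_ge0. Qed.

Lemma exp_cost_fin (t v : R) : exp_cost t v%:E = expR (- (t * v)).
Proof. by []. Qed.

Lemma exp_cost_pinfty (t : R) : 0 < t -> exp_cost t +oo = 0.
Proof. by move=> t0; rewrite /exp_cost gt0_muley. Qed.

Lemma exp_costB (t r : R) (v : \bar R) : 0 < t -> v != -oo%E ->
  exp_cost t (v - r%:E) = exp_cost t v * expR (t * r).
Proof.
case: v => [v||//] t0 _.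
  by rewrite -EFinB !exp_cost_fin -expRD; congr expR; ring.
by rewrite addye // exp_cost_pinfty // mul0r.
Qed.

Lemma has_route_tail d a : 0 < alpha P d a -> has_route P d (head a) ->
  has_route P d (tail a).
Proof.
move=> al; apply: connect_trans; apply: connect1.
exact: (@edge_link _ (fun a => 0 < alpha P d a)).
Qed.

Lemma has_route_head d i : i != val d -> has_route P d i ->
  exists a, [/\ tail a = i, 0 < alpha P d a & has_route P d (head a)].
Proof.
move=> + /connectP[[|j p] /=]; first by move=> /negP+ _ ij; case; apply/eqP.
move=> _ /andP[/existsP[a /and3P[/eqP ti /eqP hj al]] pj] ed.
by exists a; split=> //; apply/connectP; exists p; rewrite ?hj.
Qed.

(** Solving the recursion for s_i gives the log-sum formula
s_i = - ln (sum_a alpha_a exp (- theta (c_a + s_head))) / theta, whose right-hand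
side only uses nodes downstream of i.  The sum is positive when i has a route. *)
Lemma exists_bellman d : exists s, bellman d s.
Proof.
pose w (s : node G -> \bar R) i :=
  \sum_(a | tail a == i)
    alpha P d a * exp_cost (theta P d i) ((c a)%:E + s (head a))%E.
pose F (s : node G -> \bar R) i : \bar R :=
  if i == val d then 0%E else
  if has_route P d i then (- (theta P d i)^-1 * ln (w s i))%:E else +oo%E.
have [s sF] : exists s, forall i, s i = F s i.
  apply: (@measure_fixpoint _ _ (@rank G) #|node G|.+1 F 0%E) => [i|f g i fg].
    by rewrite ltnS rank_le.
  rewrite /F; have -> // : w f i = w g i.
  by apply: eq_bigr => a /eqP ti; rewrite fg // -ti rank_head.
have route_d : has_route P d (val d) by exact: connect0.
have s_d : s (val d) = 0%E by rewrite sF /F eqxx.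
have s_fin i : has_route P d i -> s i \is a fin_num.
  by rewrite sF /F => ->; case: ifP.
have s_inf i : ~~ has_route P d i -> s i = +oo%E.
  rewrite sF /F => ri; rewrite (negbTE ri); case: eqP => // id.
  by rewrite id route_d in ri.
exists s; split=> // i id ri.
have w0 : 0 < w s i.
  have [a [ti al ra]] := has_route_head id ri.
  rewrite /w (bigD1 a) /=; last by rewrite ti.
  apply: ltr_pwDl; last first.
    by apply: sumr_ge0 => b _; rewrite mulr_ge0 ?alpha_ge0 ?exp_cost_ge0.
  by rewrite -(fineK (s_fin _ ra)) -EFinD exp_cost_fin mulr_gt0 // expR_gt0.
have t0 := theta_gt0 P d i.
have -> : s i = (- (theta P d i)^-1 * ln (w s i))%:E.
  by rewrite sF /F (negbTE id) ri.
under eq_bigr => a _.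
  rewrite exp_costB //; last first.
    by have [/s_fin/fineK <-|/s_inf ->] := boolP (has_route P d (head a)).
  rewrite mulrA.
  over.
rewrite -mulr_suml -/(w s i) mulNr mulrN mulrA divff ?gt_eqF // mul1r expRN.
by rewrite lnK ?posrE // divff // gt_eqF.
Qed.

(** * Choice probabilities *)

Section Choice.
Variables (s : node G -> dest M -> \bar R) (d : dest M).
Hypothesis sB : bellman d (s ^~ d).

Let p := choice_prob P c s d.

Lemma choice_prob_ge0 a : 0 <= p a.
Proof.
by rewrite divr_ge0 ?sumr_ge0 // => [|b _]; rewrite mulr_ge0 ?alpha_ge0 ?exp_cost_ge0.
Qed.

Lemma bellman_cost_neqNy a : ((c a)%:E + s (head a) d)%E != -oo%E.
Proof.
case: sB => _ sfin sinf _.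
by case: (boolP (has_route P d (head a))) => [/sfin/fineK <-|/sinf ->].
Qed.

(** The Bellman equation says that the denominator of the logit quotient is
exp (- theta s_tail), which can then be absorbed in the exponent. *)
Lemma choice_probE a : tail a != val d -> has_route P d (tail a) ->
  p a = alpha P d a *
    exp_cost (theta P d (tail a)) ((c a)%:E + s (head a) d - s (tail a) d)%E.
Proof.
move=> ad ra; case: (sB) => _ sfin _ /(_ _ ad ra) /esym.
have /fineK <- := sfin _ ra; set t := theta P d _; set r := fine _.
have t0 : 0 < t by exact: theta_gt0.
under eq_bigr => b _ do rewrite (exp_costB _ t0 (bellman_cost_neqNy _)) mulrA.
rewrite -mulr_suml (exp_costB _ t0 (bellman_cost_neqNy _)) mulrA => /eqP.
set W := \sum_(b | _) _ => /eqP W1.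
have -> : p a = alpha P d a * exp_cost t ((c a)%:E + s (head a) d)%E / W.
  by congr (_ / _); apply: eq_bigr => b /eqP tb; rewrite /= tb.
congr (_ * _).
have W0 : W != 0 by apply: contra_eq_neq W1 => ->; rewrite mul0r eq_sym oner_eq0.
by apply: (mulfI W0); rewrite W1 divff.
Qed.

(** A link whose head has no route gets probability 0, as its exponent is -oo. *)
Lemma choice_prob_gt0 a : 0 < p a -> 0 < alpha P d a /\ has_route P d (head a).
Proof.
move=> pa; split; apply: contraPT pa => h.
- have al : alpha P d a = 0.
    by apply/eqP; rewrite eq_le alpha_ge0 andbT leNgt.
  by rewrite /p /choice_prob al !mul0r ltxx.
- case: (sB) => _ _ sinf _; rewrite /p /choice_prob sinf // addey //.
  by rewrite exp_cost_pinfty ?theta_gt0 // mulr0 mul0r ltxx.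
Qed.

Lemma sum_choice_prob i : i != val d -> has_route P d i ->
  \sum_(a | tail a == i) p a = 1.
Proof.
move=> id ri; case: (sB) => _ _ _ /(_ i id ri) ->; apply: eq_bigr => a /eqP ti.
by rewrite choice_probE ti.
Qed.

(** The marginal cost of link a, including the entropy of being chosen with
probability p a, is a difference of node potentials. *)
Lemma ln_choice_prob a : tail a != val d -> 0 < alpha P d a ->
  has_route P d (head a) ->
  0 < p a /\ c a + (theta P d (tail a))^-1 * (ln (p a) - ln (alpha P d a)) =
             fine (s (tail a) d) - fine (s (head a) d).
Proof.
move=> ad al rh; have rt := has_route_tail al rh.
case: (sB) => _ sfin _ _; rewrite choice_probE //.
have t0 := theta_gt0 P d (tail a).
have -> : ((c a)%:E + s (head a) d - s (tail a) d =
    (c a + fine (s (head a) d) - fine (s (tail a) d))%:E)%E.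
  by rewrite EFinB EFinD !fineK // sfin.
rewrite exp_cost_fin.
split; first by rewrite mulr_gt0 // expR_gt0.
rewrite lnM ?posrE ?expR_gt0 // expRK; field.
by rewrite gt_eqF.
Qed.

(** The minimum of the objective when it is finite at some feasible flow.  Nodes
without route, where the expected cost is +oo, contribute 0 through [fine]. *)
Definition expected_demand_cost : R := \sum_i q d i * fine (s i d).

(** The objective exceeds [expected_demand_cost] by the relative entropy of the
splits of x with respect to p.  The linear parts of the divergences cancel in the
sum over the links leaving a node, where both x and p * outflow add up to the
outflow. *)
Lemma free_energy_divergence x : dest_feasible d x ->
  (forall a, 0 < x a -> 0 < alpha P d a) ->
  free_energy d P c x = expected_demand_cost +
    \sum_a (theta P d (tail a))^-1 * divergence (x a) (p a * outflow x (tail a)).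
Proof.
move=> fx xal; have [x0 xcons] := fx.
have outd := outflow_dest fx.
have -> : expected_demand_cost =
    \sum_a x a * (fine (s (tail a) d) - fine (s (head a) d)).
  rewrite (sum_potential x (fun i => fine (s i d))); apply: eq_bigr => i _.
  have [->|id] := eqVneq i (val d); last by rewrite xcons.
  by case: (sB) => -> _ _ _; rewrite !mulr0.
(* Nodes with zero outflow, in particular d, contribute nothing; at the others
   the probabilities sum to 1 because such nodes have a route. *)
have excess : \sum_a (theta P d (tail a))^-1 *
    (p a * outflow x (tail a) - x a) = 0.
  rewrite sum_by_tail; apply: big1 => i _.
  under eq_bigr => a /eqP ti do rewrite ti.
  rewrite -mulr_sumr sumrB -mulr_suml -/(outflow x i).
  have [oi|oi] := eqVneq (outflow x i) 0; first by rewrite oi mulr0 subrr mulr0.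
  have id : i != val d by apply: contra oi => /eqP ->; rewrite outd.
  rewrite sum_choice_prob // ?mul1r ?subrr ?mulr0 //.
  by apply: support_reaches fx xal _; rewrite lt_neqAle eq_sym oi outflow_ge0.
rewrite -[LHS]addr0 -[in LHS]excess -!big_split /=; apply: eq_bigr => a _.
have := x0 a; rewrite le_eqVlt => /predU1P[xa|xa].
  by rewrite /divergence -xa !mul0r; ring.
have [oa ad] := support_tail fx xa.
have [pa <-] := ln_choice_prob ad (xal _ xa) (support_head fx xal xa).
move: (p a) (outflow x (tail a)) pa oa => r o r0 o0; rewrite /divergence.
have -> : ln (x a / o) = ln (x a / (r * o)) + ln r.
  rewrite -lnM ?posrE ?divr_gt0 ?mulr_gt0 //; congr ln; field.
  by rewrite !gt_eqF.
by ring.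
Qed.

(** Absolute continuity of x with respect to p * outflow, as required for the
divergences to be meaningful. *)
Lemma support_choice x a : dest_feasible d x ->
  (forall a, 0 < x a -> 0 < alpha P d a) -> 0 < x a ->
  0 < p a * outflow x (tail a).
Proof.
move=> fx xal xa; have [oa ad] := support_tail fx xa.
by have [pa _] := ln_choice_prob ad (xal _ xa) (support_head fx xal xa); rewrite mulr_gt0.
Qed.

(** * Loaded flows *)

(** The splitting rule is imposed at d as well, where it reads 0 = 0, so that it
holds uniformly; [loadedP] recovers the form with d left out. *)
Definition loaded x : Prop :=
  dest_feasible d x /\ forall a, x a = p a * outflow x (tail a).

Lemma loadedP x : dest_feasible d x ->
  loaded x <-> forall a, tail a != val d -> x a = p a * outflow x (tail a).
Proof.
move=> fx; split=> [[_ xp] a _ //|xp]; split=> // a.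
have [ad|/xp //] := eqVneq (tail a) (val d).
have od := outflow_dest fx; rewrite ad od mulr0.
by apply: outflow_eq0; [case: fx|rewrite ad].
Qed.

Lemma loaded_supported x : loaded x -> forall a, 0 < x a -> 0 < alpha P d a.
Proof.
move=> [fx xp] a xa; have [oa _] := support_tail fx xa.
by move: xa; rewrite xp pmulr_lgt0 // => /choice_prob_gt0[].
Qed.

(** All divergences vanish at a loaded flow and are nonnegative at any other, so it
is a minimizer; a second minimizer has zero divergences too, hence is loaded, and
it has the same throughputs by induction downstream. *)
Lemma minimizers_loaded x : loaded x -> minimizers P d c = [set x]%classic.
Proof.
move=> lx; have [fx xp] := lx; have xal := loaded_supported lx.
have feas0 y a : dest_feasible d y -> 0 <= p a * outflow y (tail a).
  by move=> [y0 _]; rewrite mulr_ge0 ?choice_prob_ge0 ?outflow_ge0.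
have objE y : dest_feasible d y -> (forall a, 0 < y a -> 0 < alpha P d a) ->
    objective P d c y = (expected_demand_cost +
      \sum_a (theta P d (tail a))^-1 * divergence (y a) (p a * outflow y (tail a)))%:E.
  move=> fy yal; rewrite -free_energy_divergence // objective_supported //.
  by case: fy.
have term_ge0 y a : dest_feasible d y -> (forall a, 0 < y a -> 0 < alpha P d a) ->
    0 <= (theta P d (tail a))^-1 * divergence (y a) (p a * outflow y (tail a)).
  move=> fy yal; rewrite mulr_ge0 ?invr_ge0 ?(ltW (theta_gt0 _ _ _)) //.
  by apply: divergence_ge0; [case: fy|exact: feas0|exact: support_choice].
have objx : objective P d c x = expected_demand_cost%:E.
  rewrite objE // big1 ?addr0 // => a _.
  have /eqP -> : divergence (x a) (p a * outflow x (tail a)) == 0.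
    by rewrite divergence_eq0 -?xp //; case: fx.
  by rewrite mulr0.
have xmin y : dest_feasible d y -> (objective P d c x <= objective P d c y)%E.
  move=> fy; have [|yfin] := leP +oo%E (objective P d c y).
    by apply: le_trans; exact: leey.
  have yal := supported_objective (proj1 fy) yfin.
  by rewrite objx objE // lee_fin lerDl sumr_ge0 // => a _; exact: term_ge0.
apply/seteqP; split=> [y [fy yfin ymin]|_ ->]; last first.
  by split=> //; rewrite objx ltry.
have yal := supported_objective (proj1 fy) yfin.
have := ymin _ fx; rewrite objx objE // lee_fin gerDl => sum_le0.
have /eqP/psumr_eq0P div0 : \sum_a (theta P d (tail a))^-1 *
    divergence (y a) (p a * outflow y (tail a)) == 0.
  by rewrite eq_le sum_le0 sumr_ge0 // => a _; exact: term_ge0.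
have yp a : y a = p a * outflow y (tail a).
  have /eqP := div0 (fun a _ => term_ge0 y a fy yal) a isT.
  rewrite mulf_eq0 invr_eq0 gt_eqF ?theta_gt0 //= divergence_eq0.
  - by move/eqP.
  - by case: fy.
  - exact: feas0.
  - exact: support_choice.
have out_eq i : outflow x i = outflow y i.
  elim/upstream_ind: i => i IHi.
  have [->|id] := eqVneq i (val d); first by rewrite !outflow_dest.
  have inflowE z : dest_feasible d z -> (forall a, z a = p a * outflow z (tail a)) ->
      outflow z i = q d i + \sum_(a | head a == i) p a * outflow z (tail a).
    by move=> [_ /(_ _ id) zcons] zp; rewrite -zcons (eq_bigr (fun a => z a)) ?subrK.
  rewrite !inflowE //; congr (_ + _); apply: eq_bigr => a /eqP ha.
  by rewrite IHi.
by apply/ffunP => a; rewrite yp xp out_eq.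
Qed.

(** Demand is propagated downstream: the throughput of i is its own demand plus the
share p of the throughputs of its predecessors.  The reference flow y guarantees
that demand only arises at nodes with a route; at a node without one, p would not
sum to 1 and conservation would fail. *)
Lemma exists_loaded y : dest_feasible d y ->
  (forall a, 0 < y a -> 0 < alpha P d a) -> exists x, loaded x.
Proof.
move=> fy yal.
(* Whatever reaches d is absorbed there, so d passes nothing on. *)
pose F (thru : node G -> R) i : R :=
  if i == val d then 0 else q d i + \sum_(a | head a == i) p a * thru (tail a).
have [thru thruE] : exists thru, forall i, thru i = F thru i.
  (* The measure decreases against the links. *)
  apply: (@measure_fixpoint _ _ (fun i => #|node G| - @rank G i)%N #|node G|.+1 F 0).
    by move=> i; rewrite ltnS leq_subr.
  move=> f g i fg; rewrite /F; case: ifP => // _; congr (_ + _).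
  apply: eq_bigr => a /eqP hi; rewrite fg // -hi.
  exact: ltn_sub2l (leq_trans (rank_head a) (rank_le _)) (rank_head a).
have thru_ge0 i : 0 <= thru i.
  elim/upstream_ind: i => i IHi; rewrite thruE /F; case: ifP => // _.
  rewrite addr_ge0 ?demand_ge0 // sumr_ge0 // => a /eqP ha.
  by rewrite mulr_ge0 ?choice_prob_ge0 ?IHi.
have thru_route i : 0 < thru i -> has_route P d i.
  rewrite thruE /F; case: eqVneq => [-> _|id oi]; first exact: connect0.
  apply: contraPT oi => ri; apply/negP; rewrite -leNgt.
  rewrite big1 ?addr0 => [|a /eqP ha].
    rewrite leNgt; apply: contra ri => qi; apply: (support_reaches fy yal).
    case: fy => y0 /(_ _ id) /eqP; rewrite subr_eq => /eqP ->.
    by rewrite ltr_pwDl // sumr_ge0.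
  have [pa|] := ltP 0 (p a).
    by have [_] := choice_prob_gt0 pa; rewrite ha (negbTE ri).
  by move=> pa; rewrite (@le_anti _ _ (p a) 0) ?mul0r // pa choice_prob_ge0.
exists [ffun a => p a * thru (tail a)].
have outE i : outflow [ffun a => p a * thru (tail a)] i = thru i.
  rewrite /outflow (eq_bigr (fun a => p a * thru i)); last first.
    by move=> a /eqP ti; rewrite ffunE ti.
  have [oi|oi] := eqVneq (thru i) 0.
    by rewrite oi big1 // => a _; rewrite mulr0.
  have ri : has_route P d i by apply: thru_route; rewrite lt_neqAle eq_sym oi thru_ge0.
  have id : i != val d by apply: contra oi => /eqP ->; rewrite thruE /F eqxx.
  by rewrite -mulr_suml sum_choice_prob // mul1r.
split; last by move=> a; rewrite ffunE outE.
split=> [a|i id]; first by rewrite ffunE mulr_ge0 ?choice_prob_ge0.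
rewrite outE thruE /F (negbTE id) /inflow.
by under [X in _ - X]eq_bigr do rewrite ffunE; rewrite addrK.
Qed.

End Choice.
End ExpectedCosts.

(** * Equilibrium and fixed points *)

(** The equilibrium conditions decouple: given the link costs, those on s are the
Bellman equations of each destination, and those on the flows say that each
destination's demand is loaded with the resulting probabilities. *)
Lemma equilibrium_loadedP (R : realType) (G : network) (M : demand R G)
    (K : costs R G) (P : ngev_params M) (c : flow R G) (xh : dest M -> flow R G)
    (s : node G -> dest M -> \bar R) :
  ngev_equilibrium K P c xh s <->
  [/\ (demand_feasible M `&` supply_feasible K)%classic (total_flow xh),
      forall a, (c a)%:E = link_cost K (total_flow xh) a,
      forall d, bellman P c d (s ^~ d)
    & forall d, loaded P c s d (xh d)].
Proof.
split=> [[[feas supply costE] [s_dest s_fin s_inf] s_eq flowE]|].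
  split=> // d; first by split=> // [i|i|i]; [exact: s_fin|exact: s_inf|exact: s_eq].
  by apply/loadedP => [|a ad]; [exact: feas|exact: flowE].
move=> [supply costE sB sL]; split.
- by split=> // d; case: (sL d).
- by split=> [d|d i|d i]; case: (sB d) => [sd sf si _] //; [exact: sf|exact: si].
- by move=> d i; case: (sB d) => _ _ _; apply.
- by move=> d a _; case: (sL d) => _; apply.
Qed.

Theorem proposition5p1 (R : realType) (G : network) (M : demand R G)
    (K : costs R G) (P : ngev_params M) (xh : dest M -> flow R G) :
  (exists (c : flow R G) (s : node G -> dest M -> \bar R),
     ngev_equilibrium K P c xh s) <->
  FP_D K P xh.
Proof.
split=> [[c [s /equilibrium_loadedP[supply costE sB xL]]]|[supply xopt]].
  split=> // d; rewrite /optimal_flow.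
  have -> : [ffun a => fine (link_cost K (total_flow xh) a)] = c.
    by apply/ffunP => a; rewrite ffunE -costE.
  exact: (@minimizers_loaded _ _ _ _ _ s).
set c := [ffun a => fine (link_cost K (total_flow xh) a)] in xopt.
have /choice[s sB] : forall d, exists s, bellman P c d s.
  by move=> d; exact: exists_bellman.
pose sw i d := s d i.
exists c, sw; apply/equilibrium_loadedP; split=> // [a|d].
  by rewrite ffunE fineK //; case: supply => _ [].
have xmin : minimizers P d c (xh d) by rewrite xopt.
have [fx xfin _] := xmin.
have xal := supported_objective (proj1 fx) xfin.
have [y yL] := @exists_loaded _ _ _ _ _ sw _ (sB d) _ fx xal.
by move: xmin; rewrite (@minimizers_loaded _ _ _ _ _ sw _ (sB d) _ yL) => ->.
Qed.
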